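(* Let $X,Y$ be real Hilbert spaces, $A:X\to Y$ a bounded linear ill-posed operator, and $y\in Rg(A)$. Fix $x_0\in X$, $\tau>1$, $\alpha\in[0,1)$, a sequence of nonnegative reals $(\lambda_k)_{k\ge0}$, and a nonnegative sequence $(\theta_k)_{k\ge0}$ with $\sum_k\theta_k<\infty$. Let $(\delta^j)_j$ be a sequence of positive reals converging to zero, and let $(y^{\delta^j})_j\subset Y$ satisfy $\|y^{\delta^j}-y\|\le\delta^j$ for all $j$. For each $j\in\mathbb{N}$, let $(x_l^{\delta^j})_{l=-1}^{k_j^*}$ and $(w_l^{\delta^j})_{l=0}^{k_j^*-1}$ be the sequences generated by the noisy-data iniT algorithm with data $(\delta^j,y^{\delta^j})$, with inertial parameters $\alpha_l^{\delta^j}$ given by the $\theta$-rule, and with corresponding stopping index $k_j^*=k^*(\delta^j,y^{\delta^j})$. Let $(x_k)$, $(w_k)$ be the sequences generated by the exact-data iniT algorithm with data $y$ and inertial parameters $\alpha_k$ given by the $\theta$-rule. (Algorithms and $\theta$-rule are described in the context.) Then either the sequences $(x_k)$, $(w_k)$ are not finite and $$\lim_{j\to\infty}x_k^{\delta^j}=x_k,\qquad \lim_{j\to\infty}w_k^{\delta^j}=w_k,\qquad k=0,1,\dots,$$ or the sequences $(x_k)=(x_k)_{k=-1}^{k_0}$, $(w_k)=(w_k)_{k=0}^{k_0-1}$ are finite for some $k_0\in\mathbb{N}$ and $$\lim_{j\to\infty}x_k^{\delta^j}=x_k,\ \ 0\le k\le k_0,\qquad\text{and}\qquad \lim_{j\to\infty}w_k^{\delta^j}=w_k,\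 \ 0\le k\le k_0-1$$ (in this case, $x_{k_0}\in X$ is a solution of $Ax=y$).
   Context: Ill-posed means that the inverse $A^{-1}:Y\to X$ either does not exist or is not continuous. $A^*$ is the adjoint of $A$, $Rg(A)$ its range. Exact-data iniT algorithm: set $x_{-1}:=x_0$. For $k=0,1,2,\dots$, as long as $\|Ax_k-y\|>0$: choose $\alpha_k\in[0,\alpha]$, set $w_k:=x_k+\alpha_k(x_k-x_{k-1})$, and let $x_{k+1}$ be the unique solution of $\lambda_kA^*(Ax_{k+1}-y)+x_{k+1}-w_k=0$. If $Ax_{k_0}=y$ for some (first) $k_0$, the iteration stops, having produced $x_{-1},x_0,\dots,x_{k_0}$ and $w_0,\dots,w_{k_0-1}$. Noisy-data iniT algorithm (with data $(\delta,y^\delta)$): set $x_{-1}^\delta:=x_0^\delta:=x_0$. For $k=0,1,2,\dots$, as long as $\|Ax_k^\delta-y^\delta\|>\tau\delta$: choose $\alpha_k^\delta\in[0,\alpha]$, set $w_k^\delta:=x_k^\delta+\alpha_k^\delta(x_k^\delta-x_{k-1}^\delta)$, and let $x_{k+1}^\delta$ be the unique solution of $\lambda_kA^*(Ax_{k+1}^\delta-y^\delta)+x_{k+1}^\delta-w_k^\delta=0$. The stopping index is $k^*=k^*(\delta,y^\delta):=\min\{k\in\mathbb{N}:\ \|Ax_k^\delta-y^\delta\|\le\tau\delta\}$ ($0\in\mathbb N$; $k^*=\infty$ if the iteration never stops), so the algorithm generates $(x_k^\delta)_{k=-1}^{k^*}$ and $(w_k^\delta)_{k=0}^{k^*-1}$.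 $\theta$-rule: $\alpha_0=\alpha$ and, for $k\ge1$, $\alpha_k=\min\{\theta_k/\|x_k-x_{k-1}\|^2,\ \theta_k,\ \alpha\}$ if $\|x_k-x_{k-1}\|>0$, and $\alpha_k=0$ otherwise; in the noisy case the same rule is used with $\alpha_k^\delta,x_k^\delta,x_{k-1}^\delta$ in place of $\alpha_k,x_k,x_{k-1}$. For a fixed $k$, the limits as $j\to\infty$ are understood along those $j$ for which the iterates are defined, which includes the assertion that $x_k^{\delta^j}$ (resp. $w_k^{\delta^j}$) is defined for all sufficiently large $j$. *)

(* Defs.v *)
From HB Require Import structures.
From mathcomp Require Import all_boot all_order all_algebra sesquilinear.
From mathcomp Require Import all_classical all_reals all_analysis.

Set Implicit Arguments.
Unset Strict Implicit.
Unset Printing Implicit Defensive.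

Import Order.TTheory GRing.Theory Num.Theory.
Import numFieldNormedType.Exports.

Local Open Scope classical_set_scope.
Local Open Scope ring_scope.

(* Real Hilbert spaces: complete normed spaces whose norm comes from a
   symmetric positive definite bilinear form. *)
HB.mixin Record isHilbert (R : realType) X of CompleteNormedModule R X := {
  inner : {dot X for idfun};
  inner_norm : forall u : X, inner u u = `|u| ^+ 2
}.

#[short(type="hilbertType")]
HB.structure Definition Hilbert (R : realType) :=
  {X of isHilbert R X & CompleteNormedModule R X}.

Definition dotp (R : realType) (X : hilbertType R) (u v : X) : R :=
  @inner R X u v.

Section Operators.
Variables (R : realType) (X Y : hilbertType R).

Definition bounded_operator (A : X -> Y) : Prop :=
  exists M : R, forall u, `|A u| <= M * `|u|.

(* The map B with <A u, v> = <u, B v>. It is unique, and it exists for every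
   bounded linear A (Riesz), so the default value 0 is not reached there. *)
Definition adjoint (A : X -> Y) : Y -> X :=
  xget (fun=> 0) [set B : Y -> X | forall u v, dotp (A u) v = dotp u (B v)].

Definition ill_posed (A : X -> Y) : Prop :=
  ~ (exists B : Y -> X, cancel A B /\ cancel B A) \/
  exists B : Y -> X, [/\ cancel A B, cancel B A & ~ continuous B].

(* [None] stands for an infinite stopping index. *)
Definition is_first_index (stop : nat -> Prop) (ks : option nat) : Prop :=
  if ks is Some k0 then stop k0 /\ forall k, (k < k0)%N -> ~ stop k
  else forall k, ~ stop k.

Definition le_index (k : nat) (ks : option nat) : bool :=
  if ks is Some k0 then (k <= k0)%N else true.

Definition lt_index (k : nat) (ks : option nat) : bool :=
  if ks is Some k0 then (k < k0)%N else true.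

(* The sequences (x_k) for k = -1, ..., ks and (a_k), (w_k) for k < ks are
   generated from the data y, with the iteration going on as long as
   |A x_k - y| > tol. Sequences are total functions, but values beyond the
   stopping index are unconstrained and meaningless. The convention
   x_(-1) = x_0 is carried by the predecessor: x 0.-1 is x 0. *)
Definition iniT (A : X -> Y) (lam : nat -> R) (alpha : R) (x0 : X)
    (tol : R) (y : Y) (a : nat -> R) (x w : nat -> X) (ks : option nat) :
    Prop :=
  [/\ x 0%N = x0,
      is_first_index (fun k => `|A (x k) - y| <= tol) ks &
      forall k, lt_index k ks ->
        [/\ 0 <= a k <= alpha,
            w k = x k + a k *: (x k - x k.-1) &
            lam k *: adjoint A (A (x k.+1) - y) + x k.+1 - w k = 0]].

Definition iniT_exact A lam alpha x0 y := iniT A lam alpha x0 0 y.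

Definition iniT_noisy A lam alpha x0 tau delta yd :=
  iniT A lam alpha x0 (tau * delta) yd.

Definition theta_rule (alpha : R) (theta : nat -> R) (a : nat -> R)
    (x : nat -> X) (ks : option nat) : Prop :=
  forall k, lt_index k ks ->
    a k = if k == 0%N then alpha
          else if 0 < `|x k - x k.-1| then
            Num.min (theta k / `|x k - x k.-1| ^+ 2)
                    (Num.min (theta k) alpha)
          else 0.

(* Limit along the indices j in D, together with the assertion that D contains
   all sufficiently large j. *)
Definition cvg_along (D : set nat) (u : nat -> X) (l : X) : Prop :=
  (\forall j \near \oo, D j) /\ u j @[j --> within D \oo] --> l.

End Operators.

(* Main.v *)
Require Import Defs.
From HB Require Import structures.
From mathcomp Require Import all_boot all_order all_algebra sesquilinear.
From mathcomp Require Import all_classical all_reals all_analysis.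
From mathcomp Require Import lra ring.

Set Implicit Arguments.
Unset Strict Implicit.
Unset Printing Implicit Defensive.

Import Order.TTheory GRing.Theory Num.Theory.
Import numFieldNormedType.Exports.

Local Open Scope classical_set_scope.
Local Open Scope ring_scope.

(** For a fixed index k that the exact run reaches, computing the k-th iterate
    takes finitely many steps, each of which passes to the limit as the noise
    vanishes; the statement follows by induction on k ([iterates_cvg]). One step of the algorithm consists of three operations.

    - The stopping test. If the exact run is not stopped at k, the residual
      |A x_k - y| is positive. The noisy residuals converge to it, while the
      thresholds tau * delta_j tend to 0, so almost all noisy runs go on
      ([near_unstopped]).

    - The inertial step. The weight given by the theta-rule is continuous in
      the increment x_k - x_(k-1) wherever this increment is nonzero. At a zero
      increment it may jump, but there the weights stay in [0, alpha] and multiply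
      increments that tend to 0, so the extrapolated point still converges
      ([inertial_step_cvg]).

    - The implicit step. Monotonicity of u |-> A^*(A u - v) makes the solution
      of l A^*(A u - v) + u = w depend continuously on v and w
      ([implicit_step_stable], [implicit_step_cvg]).

    Each step keeps almost all noisy runs defined, so convergence along the
    indices of runs reaching step k follows from convergence along all indices,
    whatever the meaningless values of the remaining runs are. *)

(** * Stability of the implicit step *)

Lemma dotpC (R : realType) (X : hilbertType R) (u v : X) : dotp u v = dotp v u.
Proof. by rewrite /dotp hermC expr0 mul1r. Qed.

Lemma dotpp (R : realType) (X : hilbertType R) (u : X) : dotp u u = `|u| ^+ 2.
Proof. exact: inner_norm. Qed.

Lemma sqr_normB (R : realType) (X : hilbertType R) (u v : X) :
  `|u - v| ^+ 2 = `|u| ^+ 2 - 2 * dotp u v + `|v| ^+ 2.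
Proof.
rewrite -!dotpp /dotp linearBl !linearBr /= -!/(dotp _ _) (dotpC v u).
ring.
Qed.

(** In the second alternative the implicit step reduces to u = w, which is as
    stable as the step with a genuine adjoint. *)
Lemma adjoint_spec (R : realType) (X Y : hilbertType R) (A : X -> Y) :
  (forall u v, dotp (A u) v = dotp u (adjoint A v)) \/ adjoint A = fun=> 0.
Proof.
by rewrite /adjoint; case: xgetP => [B _ AB|_]; [left|right].
Qed.

(** With d = A (u - u') and e = v - v', the inner product equals <d - e, d>,
    and |e|^2/4 + <d - e, d> = |d - e/2|^2 is nonnegative. When the adjoint is
    the zero map both sides have the evident sign, so the estimate holds for
    both alternatives of [adjoint_spec]. *)
Lemma adjoint_residual_monotone (R : realType) (X Y : hilbertType R)
    (A : {linear X -> Y}) (u u' : X) (v v' : Y) :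
  - (`|v - v'| ^+ 2 / 4) <=
  dotp (u - u') (adjoint A (A u - v) - adjoint A (A u' - v')).
Proof.
have [AB|->] := adjoint_spec A; last first.
  by rewrite subr0 /dotp linear0r oppr_le0 divr_ge0 ?sqr_ge0.
have -> : dotp (u - u') (adjoint A (A u - v) - adjoint A (A u' - v')) =
          dotp (A (u - u')) (A (u - u') - (v - v')).
  rewrite /dotp linearBr /= -!/(dotp _ _) -!AB /dotp -linearBr /=.
  by rewrite (linearB A) !opprD !opprK addrACA.
set d := A _; set e := v - v'.
rewrite /dotp linearBr /= -!/(dotp _ _) dotpp.
(* |2d - e|^2 / 4 is the square |d - e/2|^2. *)
have := sqr_ge0 `|d *+ 2 - e|; rewrite sqr_normB.
have -> : dotp (d *+ 2) e = dotp d e *+ 2 by exact: linearMnl.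
rewrite normrMn.
by lra.
Qed.

(** Pairing the difference of the two equations with d = u - u' gives
    |d|^2 + l <d, g> = <d, w - w'>, where g is the difference of the adjoint
    terms. Monotonicity bounds <d, g> from below, and
    <d, w - w'> <= (|d|^2 + |w - w'|^2) / 2. *)
Lemma implicit_step_stable (R : realType) (X Y : hilbertType R)
    (A : {linear X -> Y}) (l : R) (u u' w w' : X) (v v' : Y) :
  0 <= l ->
  l *: adjoint A (A u - v) + u - w = 0 ->
  l *: adjoint A (A u' - v') + u' - w' = 0 ->
  `|u - u'| ^+ 2 <= l / 2 * `|v - v'| ^+ 2 + `|w - w'| ^+ 2.
Proof.
move=> l0 /subr0_eq<- /subr0_eq<-.
rewrite opprD addrACA -scalerBr.
set g := adjoint A _ - _; set d := u - u'; set f := _ + d.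
have := sqr_ge0 `|d - f|; rewrite (sqr_normB d f).
have -> : dotp d f = l * dotp d g + `|d| ^+ 2.
  by rewrite /dotp linearDr linearZr_LR /= -!/(dotp _ _) dotpp.
have := ler_wpM2l l0 (adjoint_residual_monotone A u u' v v').
rewrite -/d -/g.
by lra.
Qed.

(** * Limits in normed spaces *)

Lemma cvg_dist0 (K : realFieldType) (V : normedModType K) (u : nat -> V) (l : V) :
  u @ \oo --> l -> `|u j - l| @[j --> \oo] --> (0 : K).
Proof.
by move=> /(subr_cvg0 u l) /cvg_norm; rewrite normr0; apply.
Qed.

Lemma cvg_dist_squeeze (K : realFieldType) (V : normedModType K) (T : Type)
    (F : set_system T) (FF : Filter F) (u : T -> V) (l : V) (b : T -> K) :
  (\forall t \near F, `|u t - l| <= b t) -> b @ F --> 0 -> u @ F --> l.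
Proof.
move=> ub b0; apply/(subr_cvg0 (F := F)); apply: norm_cvg0.
apply: (squeeze_cvgr _ (cvg_cst 0) b0).
by apply: filterS ub => t ubt; rewrite normr_ge0.
Qed.

Lemma cvg_sqr (K : realFieldType) (u : nat -> K) (l : K) :
  u @ \oo --> l -> u j ^+ 2 @[j --> \oo] --> l ^+ 2.
Proof. by move=> uc; exact: (cvgM uc uc). Qed.

Lemma implicit_step_cvg (R : realType) (X Y : hilbertType R)
    (A : {linear X -> Y}) (l : R) (u w : nat -> X) (v : nat -> Y)
    (u0 w0 : X) (v0 : Y) :
  0 <= l -> v @ \oo --> v0 -> w @ \oo --> w0 ->
  l *: adjoint A (A u0 - v0) + u0 - w0 = 0 ->
  (\forall j \near \oo, l *: adjoint A (A (u j) - v j) + u j - w j = 0) ->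
  u @ \oo --> u0.
Proof.
move=> l0 vc wc Eu0 Eu.
have b0 : Num.sqrt (l / 2 * `|v j - v0| ^+ 2 + `|w j - w0| ^+ 2) @[j --> \oo]
     --> (0 : R).
  rewrite -[X in _ --> X]sqrtr0.
  apply: continuous_cvg; first exact: sqrt_continuous.
  rewrite -[X in _ --> X](_ : l / 2 * 0 ^+ 2 + 0 ^+ 2 = 0); last by ring.
  by apply: cvgD; [apply: cvgMl_tmp|]; apply: cvg_sqr; exact: cvg_dist0.
apply: cvg_dist_squeeze b0; apply: filterS Eu => j Ej.
have := implicit_step_stable l0 Ej Eu0.
by rewrite -ler_sqrt ?sqrtr_sqr ?normr_id // ?addr_ge0 ?mulr_ge0 ?sqr_ge0 ?divr_ge0.
Qed.

Lemma bounded_operator_continuous (R : realType) (X Y : hilbertType R)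
    (A : {linear X -> Y}) : bounded_operator A -> continuous A.
Proof.
move=> [M AM] u.
apply: (@cvg_dist_squeeze _ _ _ _ _ _ _ (fun v => M * `|v - u|)).
  by apply: nearW => v; rewrite -linearB AM.
rewrite -[X in _ --> X](mulr0 M); apply: cvgMl_tmp.
rewrite -[X in _ --> X](normr0 X); apply: cvg_norm.
by apply/(@subr_cvg0 _ _ _ (nbhs u)).
Qed.

(** * One step of the algorithm in the limit *)

Lemma is_first_index_lt (stop : nat -> Prop) (ks : option nat) (k : nat) :
  is_first_index stop ks -> lt_index k ks <-> (le_index k ks /\ ~ stop k).
Proof.
case: ks => [m|] //=.
move=> [sm ltm]; split=> [km|[]]; first by split; [exact: ltnW|exact: ltm].
by rewrite leq_eqVlt => /predU1P[->|].
Qed.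

Lemma cvg_min (R : realType) (u v : nat -> R) (k l : R) :
  u @ \oo --> k -> v @ \oo --> l ->
  Num.min (u j) (v j) @[j --> \oo] --> Num.min k l.
Proof.
move=> uc vc; apply: (@continuous2_cvg _ _ _ _ _ _ _ _ (fun r s => Num.min r s)) => //.
exact: (@min_continuous _ R (k, l)).
Qed.

(** The relation [weight] is the theta-rule at step k, with p and q in the
    roles of x_(k-1) and x_k. The rule may be discontinuous at q0 = p0, where
    the weights b j need not converge to b0; only the products with q j - p j do.
    The case k = 0 with q0 <> p0 has the constant weight alpha. *)
Lemma inertial_step_cvg (R : realType) (X : hilbertType R)
    (alpha t : R) (k : nat) (p q : nat -> X) (b : nat -> R)
    (p0 q0 : X) (b0 : R) :
  let weight c (d : X) :=
    c = if k == 0%N then alpha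
        else if 0 < `|d| then
          Num.min (t / `|d| ^+ 2) (Num.min t alpha)
        else 0 in
  p @ \oo --> p0 -> q @ \oo --> q0 ->
  weight b0 (q0 - p0) ->
  (\forall j \near \oo, 0 <= b j <= alpha) ->
  (\forall j \near \oo, weight (b j) (q j - p j)) ->
  q j + b j *: (q j - p j) @[j --> \oo] --> q0 + b0 *: (q0 - p0).
Proof.
move=> weight pc qc Eb0 b_bnd Eb; apply: cvgD => //.
have dc : q j - p j @[j --> \oo] --> q0 - p0 by exact: cvgB.
have [d0|d0] := eqVneq (q0 - p0) 0.
  rewrite d0 scaler0.
  apply: (@cvg_dist_squeeze _ _ _ _ _ _ _ (fun j => alpha * `|q j - p j|)).
    apply: filterS b_bnd => j /andP[b_ge0 b_le].
    by rewrite subr0 normrZ (ger0_norm b_ge0) ler_wpM2r.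
  rewrite -[X in _ --> X](mulr0 alpha) -[X in _ * X](normr0 X) -d0.
  by apply: cvgMl_tmp; apply: cvg_norm.
apply: cvgZ => //.
move: Eb0; rewrite /weight normr_gt0 d0 => ->.
case: k @weight Eb => [|k] weight Eb /=.
  by apply: cvg_near_cst; exact: Eb.
have d_neq0 : \forall j \near \oo, q j - p j != 0 by exact: cvgr_neq0 dc d0.
suff : Num.min (t / `|q j - p j| ^+ 2) (Num.min t alpha) @[j --> \oo]
    --> Num.min (t / `|q0 - p0| ^+ 2) (Num.min t alpha).
  apply: cvg_trans; apply: near_eq_cvg.
  by apply: filterS2 Eb d_neq0 => j -> /= dj; rewrite normr_gt0 dj.
apply: cvg_min; last exact: cvg_cst.
apply: cvgMl_tmp; apply: (@cvgV R); first by rewrite expf_neq0 ?normr_eq0.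
by apply: cvg_sqr; exact: cvg_norm.
Qed.

(** * Convergence of the noisy runs *)

Section StabilityOfRuns.
Context {R : realType} {X Y : hilbertType R} (A : {linear X -> Y}) (y : Y)
  (x0 : X) (tau alpha : R) (lam theta delta : nat -> R) (yd : nat -> Y)
  (ad : nat -> nat -> R) (xd wd : nat -> nat -> X) (ksd : nat -> option nat)
  (a : nat -> R) (x w : nat -> X) (ks : option nat).
Hypotheses (A_bounded : bounded_operator A)
  (lam_ge0 : forall k, 0 <= lam k)
  (delta_cvg0 : delta @ \oo --> 0)
  (yd_close : forall j, `|yd j - y| <= delta j)
  (noisy : forall j, iniT_noisy A lam alpha x0 tau (delta j) (yd j)
                       (ad j) (xd j) (wd j) (ksd j))
  (noisy_theta : forall j, theta_rule alpha theta (ad j) (xd j) (ksd j))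
  (exact_run : iniT_exact A lam alpha x0 y a x w ks)
  (exact_theta : theta_rule alpha theta a x ks).

Lemma noisy_data_cvg : yd @ \oo --> y.
Proof.
by apply: cvg_dist_squeeze delta_cvg0; exact: nearW.
Qed.

(** The gap between residual and threshold converges to the exact residual,
    which is positive because the exact run is not stopped. *)
Lemma near_unstopped k : lt_index k ks ->
  (\forall j \near \oo, le_index k (ksd j)) -> xd ^~ k @ \oo --> x k ->
  \forall j \near \oo, lt_index k (ksd j).
Proof.
have [_ fks _] := exact_run.
move=> /(is_first_index_lt k fks)[_ /negP]; rewrite -ltNge => res_gt0 lek xc.
have res_cvg : `|A (xd j k) - yd j| @[j --> \oo] --> `|A (x k) - y|.
  apply: cvg_norm; apply: cvgB noisy_data_cvg.
  by apply: continuous_cvg xc; exact: bounded_operator_continuous.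
have gap_cvg : `|A (xd j k) - yd j| - tau * delta j @[j --> \oo]
    --> `|A (x k) - y| - tau * 0 by apply: cvgB => //; apply: cvgMl_tmp.
have gap : \forall j \near \oo, 0 < `|A (xd j k) - yd j| - tau * delta j.
  by apply: cvgr_gt gap_cvg _ _; rewrite mulr0 subr0.
apply: filterS2 lek gap => j lej gapj; have [_ fksd _] := noisy j.
by apply/(is_first_index_lt k fksd); split=> //; apply/negP; rewrite -ltNge -subr_gt0.
Qed.

Lemma inertial_points_cvg k : lt_index k ks ->
  (\forall j \near \oo, lt_index k (ksd j)) ->
  xd ^~ k @ \oo --> x k -> xd ^~ k.-1 @ \oo --> x k.-1 ->
  wd ^~ k @ \oo --> w k.
Proof.
move=> ltk ltdk xc xc'; have [_ _ /(_ _ ltk)[_ -> _]] := exact_run.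
suff : xd j k + ad j k *: (xd j k - xd j k.-1) @[j --> \oo]
    --> x k + a k *: (x k - x k.-1).
  apply: cvg_trans; apply: near_eq_cvg.
  by apply: filterS ltdk => j ltj; have [_ _ /(_ _ ltj)[]] := noisy j.
apply: inertial_step_cvg xc' xc (exact_theta ltk) _ _.
  by apply: filterS ltdk => j ltj; have [_ _ /(_ _ ltj)[]] := noisy j.
by apply: filterS ltdk => j ltj; exact: noisy_theta.
Qed.

(** The claim carries the preceding iterate along, because the inertial step
    uses two consecutive iterates; for k = 0 the predecessor is the common
    starting point itself. *)
Lemma iterates_cvg k : le_index k ks ->
  [/\ \forall j \near \oo, le_index k (ksd j),
      xd ^~ k @ \oo --> x k & xd ^~ k.-1 @ \oo --> x k.-1].
Proof.
elim: k => [_|k IHk lek].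
  have x00 : xd ^~ 0%N @ \oo --> x 0%N.
    have [-> _ _] := exact_run; apply: cvg_near_cst.
    by apply: nearW => j; have [] := noisy j.
  by split=> //; apply: nearW => j; case: (ksd j).
have ltk : lt_index k ks := lek.
have lek' : le_index k ks by case: ks ltk => //= m; exact: ltnW.
have {IHk}[ledk xc xc'] := IHk lek'.
have ltdk := near_unstopped ltk ledk xc.
(* Running step k without stopping and reaching index k.+1 are convertible. *)
split=> //.
have [_ _ /(_ _ ltk)[_ _ Ex]] := exact_run.
apply: implicit_step_cvg noisy_data_cvg (inertial_points_cvg ltk ltdk xc xc') Ex _.
  exact: lam_ge0.
by apply: filterS ltdk => j ltj; have [_ _ /(_ _ ltj)[]] := noisy j.
Qed.

Lemma iterates_cvg_along k : le_index k ks ->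
  cvg_along [set j | le_index k (ksd j)] (xd ^~ k) (x k).
Proof.
by move=> /iterates_cvg[lek xc _]; split=> //; exact: cvg_within_filter.
Qed.

Lemma inertial_points_cvg_along k : lt_index k ks ->
  cvg_along [set j | lt_index k (ksd j)] (wd ^~ k) (w k).
Proof.
move=> ltk; have lek : le_index k ks by case: ks ltk => //= m; exact: ltnW.
have [ledk xc xc'] := iterates_cvg lek; have ltdk := near_unstopped ltk ledk xc.
by split=> //; apply: cvg_within_filter; exact: inertial_points_cvg.
Qed.

End StabilityOfRuns.

Theorem theorem2p15 (R : realType) (X Y : hilbertType R)
    (A : {linear X -> Y}) (A_bounded : bounded_operator A)
    (A_ill_posed : ill_posed A)
    (y : Y) (y_range : range A y)
    (x0 : X) (tau : R) (tau_gt1 : 1 < tau)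
    (alpha : R) (alpha_range : 0 <= alpha < 1)
    (lam : nat -> R) (lam_ge0 : forall k, 0 <= lam k)
    (theta : nat -> R) (theta_ge0 : forall k, 0 <= theta k)
    (theta_summable : cvgn (series theta))
    (delta : nat -> R) (delta_gt0 : forall j, 0 < delta j)
    (delta_cvg0 : delta j @[j --> \oo] --> (0 : R))
    (yd : nat -> Y) (yd_close : forall j, `|yd j - y| <= delta j)
    (* noisy runs: j-th parameters, iterates and stopping index *)
    (ad : nat -> nat -> R) (xd wd : nat -> nat -> X) (ksd : nat -> option nat)
    (noisy : forall j, iniT_noisy A lam alpha x0 tau (delta j) (yd j)
                         (ad j) (xd j) (wd j) (ksd j))
    (noisy_theta : forall j, theta_rule alpha theta (ad j) (xd j) (ksd j))
    (* exact run *)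
    (a : nat -> R) (x w : nat -> X) (ks : option nat)
    (exact_run : iniT_exact A lam alpha x0 y a x w ks)
    (exact_theta : theta_rule alpha theta a x ks) :
  (ks = None /\
   forall k,
     cvg_along [set j | le_index k (ksd j)] (fun j => xd j k) (x k) /\
     cvg_along [set j | lt_index k (ksd j)] (fun j => wd j k) (w k))
  \/
  (exists k0 : nat,
    [/\ ks = Some k0,
        forall k, (k <= k0)%N ->
          cvg_along [set j | le_index k (ksd j)] (fun j => xd j k) (x k),
        forall k, (k < k0)%N ->
          cvg_along [set j | lt_index k (ksd j)] (fun j => wd j k) (w k) &
        A (x k0) = y]).
Proof.
have x_cvg := iterates_cvg_along A_bounded lam_ge0 delta_cvg0 yd_close
  noisy noisy_theta exact_run exact_theta.
have w_cvg := inertial_points_cvg_along A_bounded lam_ge0 delta_cvg0 yd_close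
  noisy noisy_theta exact_run exact_theta.
have [_ fks _] := exact_run.
case: ks fks {exact_run exact_theta} x_cvg w_cvg => [k0|] fks x_cvg w_cvg.
  right; exists k0; split=> //; case: fks.
  by rewrite normr_le0 subr_eq0 => /eqP.
by left; split=> // k; split; [exact: x_cvg|exact: w_cvg].
Qed.
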